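(* Let $k\ge1$, $0\le l\le k$, $N\ge2$ and $0\le j\le i\le k$ be integers. The partial characters satisfy the recursion $$\chi_{k,l}^{N+1}[*;i,j](q,z_1,z_2)=\sum_{i',j'}R_k^{(N)}\bigl((i,j),(i',j')\bigr)\,\chi_{k,l}^N[*;i',j'](q,z_1,z_2),$$ where the sum is over $0\le j'\le i'\le k$, $$R_k^{(N)}\bigl((i,j),(i',j')\bigr)=q^{Ni-(N-1)(i-j-j')^+}\,z_1^{\,j'-(j+j'-i)^+}\,z_2^{\,i-(i-j-j')^+}$$ if $(i',2j-i+i',i)$ is an admissible triple of level $k$, and $R_k^{(N)}((i,j),(i',j'))=0$ otherwise.
   Context: $t^+=\max(t,0)$, and $x(\alpha,\beta,\gamma)=\frac{\alpha+\gamma-\beta}2$, $y(\alpha,\beta,\gamma)=\frac{\alpha+\beta-\gamma}2$, $z(\alpha,\beta,\gamma)=\frac{\beta+\gamma-\alpha}2$. A triple $(\alpha,\beta,\gamma)\in\{0,\dots,k\}^3$ is admissible of level $k$ if $x,y,z$ evaluated on it are non-negative integers with $x+y+z\le k$. $\mathcal P_{k,l}^N$ (Verlinde paths) is the set of $(\boldsymbol\alpha;\boldsymbol\beta)=(\alpha_1,\dots,\alpha_N;\beta_1,\dots,\beta_{N-1})\in\{0,\dots,k\}^{2N-1}$ with $\alpha_1=l$ and $(\alpha_i,\beta_i,\alpha_{i+1})$ admissible of level $k$ for $i=1,\dots,N-1$; one sets $\beta_N=\alpha_N$, $\alpha_i=0$ for $i>N$ and $\beta_i=0$ for $i>N$.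 For such a path define $a_{i-1}=y(\alpha_i,\beta_i,\alpha_{i+1})$ ($1\le i\le N$) and $b_i=z(\alpha_i,\beta_i,\alpha_{i+1})-(y(\alpha_{i+1},\beta_{i+1},\alpha_{i+2})-x(\alpha_i,\beta_i,\alpha_{i+1}))^+$ ($1\le i\le N-1$), and $$e(\boldsymbol\alpha;\boldsymbol\beta)=\sum_{i=1}^{N-1}i(a_i+b_i),\quad s_1(\boldsymbol\alpha;\boldsymbol\beta)=\sum_{i=1}^{N-1}b_i,\quad s_2(\boldsymbol\alpha;\boldsymbol\beta)=a_0+\sum_{i=1}^{N-1}(a_i+b_i).$$ For $N\ge2$ the partial character is $$\chi_{k,l}^N[*;i,j](q,z_1,z_2)=\sum q^{e(\boldsymbol\alpha;\boldsymbol\beta)}z_1^{s_1(\boldsymbol\alpha;\boldsymbol\beta)}z_2^{s_2(\boldsymbol\alpha;\boldsymbol\beta)},$$ summed over $(\boldsymbol\alpha;\boldsymbol\beta)\in\mathcal P_{k,l}^N$ with $\alpha_N=i$ and $\alpha_N+\beta_{N-1}-\alpha_{N-1}=2j$. *)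

(* Defs.v *)
From mathcomp Require Import all_boot all_order all_algebra.

Set Implicit Arguments.
Unset Strict Implicit.
Unset Printing Implicit Defensive.

Import Order.TTheory GRing.Theory Num.Theory.
Local Open Scope ring_scope.

Definition pos_part (t : int) : int := Num.max t 0.

(* The quotients by 2 are Euclidean; they are exact on admissible triples,
   whose definition includes the divisibility conditions, and on the terminal
   triples (a, a, 0). *)
Definition xcoord (a b c : int) : int := ((a + c - b) %/ 2)%Z.
Definition ycoord (a b c : int) : int := ((a + b - c) %/ 2)%Z.
Definition zcoord (a b c : int) : int := ((b + c - a) %/ 2)%Z.

Definition admissible (k : nat) (a b c : int) : bool :=
  [&& 0 <= a <= k%:Z, 0 <= b <= k%:Z, 0 <= c <= k%:Z,
      [&& (2 %| a + c - b)%Z, (2 %| a + b - c)%Z & (2 %| b + c - a)%Z],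
      [&& 0 <= xcoord a b c, 0 <= ycoord a b c & 0 <= zcoord a b c]
    & xcoord a b c + ycoord a b c + zcoord a b c <= k%:Z].

(* Pairs (alpha_1, ..., alpha_N; beta_1, ..., beta_(N-1)) in {0, ..., k}. *)
Definition labels (k N : nat) : finType :=
  (N.-tuple 'I_k.+1 * N.-1.-tuple 'I_k.+1)%type.

(* Labels are indexed from 1, and extended by alpha_i = 0 for i > N (the default
   value of nth), beta_N = alpha_N and beta_i = 0 for i > N. The index 0 is
   never used. *)
Definition alpha (k N : nat) (p : labels k N) (i : nat) : int :=
  (nth ord0 p.1 i.-1 : nat)%:Z.

Definition beta (k N : nat) (p : labels k N) (i : nat) : int :=
  if i == N then alpha p N else (nth ord0 p.2 i.-1 : nat)%:Z.

Definition xpath (k N : nat) (p : labels k N) (i : nat) : int :=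
  xcoord (alpha p i) (beta p i) (alpha p i.+1).
Definition ypath (k N : nat) (p : labels k N) (i : nat) : int :=
  ycoord (alpha p i) (beta p i) (alpha p i.+1).
Definition zpath (k N : nat) (p : labels k N) (i : nat) : int :=
  zcoord (alpha p i) (beta p i) (alpha p i.+1).

Definition verlinde_paths (k l N : nat) : {set labels k N} :=
  [set p : labels k N | (alpha p 1 == l%:Z) &&
    [forall i : 'I_N.-1,
       admissible k (alpha p i.+1) (beta p i.+1) (alpha p i.+2)]].

Definition acoef (k N : nat) (p : labels k N) (i : nat) : int := ypath p i.+1.

Definition bcoef (k N : nat) (p : labels k N) (i : nat) : int :=
  zpath p i - pos_part (ypath p i.+1 - xpath p i).

Definition energy (k N : nat) (p : labels k N) : int :=
  \sum_(1 <= i < N) i%:Z * (acoef p i + bcoef p i).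

Definition spin1 (k N : nat) (p : labels k N) : int :=
  \sum_(1 <= i < N) bcoef p i.

Definition spin2 (k N : nat) (p : labels k N) : int :=
  acoef p 0 + \sum_(1 <= i < N) (acoef p i + bcoef p i).

(* The variables q, z1, z2 are arbitrary units of a commutative ring, so that
   all exponents can be taken in int without truncation. Identities that hold
   for all such units are exactly the identities of Laurent polynomials in q,
   z1, z2 with integer coefficients (take the indeterminates of the field of
   rational functions). The character is meaningful for N >= 2. *)
Definition partial_character (A : comUnitRingType) (q z1 z2 : A)
    (k l N i j : nat) : A :=
  \sum_(p in verlinde_paths k l N |
          (alpha p N == i%:Z) &&
          (alpha p N + beta p N.-1 - alpha p N.-1 == 2 * j%:Z))
    q ^ energy p * z1 ^ spin1 p * z2 ^ spin2 p.

Definition recursion_coef (A : comUnitRingType) (q z1 z2 : A)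
    (k N i j i' j' : nat) : A :=
  if admissible k i'%:Z (2 * j%:Z - i%:Z + i'%:Z) i%:Z then
    q ^ (N%:Z * i%:Z - (N%:Z - 1) * pos_part (i%:Z - j%:Z - j'%:Z))
    * z1 ^ (j'%:Z - pos_part (j%:Z + j'%:Z - i%:Z))
    * z2 ^ (i%:Z - pos_part (i%:Z - j%:Z - j'%:Z))
  else 0.

(* Main.v *)
Require Import Defs.
From mathcomp Require Import all_boot all_order all_algebra.
From mathcomp Require Import zify ring.

(** A path of length [N.+1] is a path of length [N] followed by a pair
    [(b, a)] such that the triple [(alpha_N, b, a)] is admissible. For a path
    counted by the left-hand side, [a = i] and [b = 2 j - i + alpha_N] are
    forced, so the path amounts to its truncation [p], subject to the condition
    of admissibility in the recursion coefficient. Sorting the truncations by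
    [i' = alpha_N] and [j' = z_(N-1)] gives the shape of the right-hand side;
    every truncation has [0 <= j' <= i'], since admissibility of its last
    triple makes [z_(N-1)] and [x_(N-1) = i' - j'] nonnegative
    ([sum_over_ends]).

    It remains to compare the statistics of the two paths. Only the entries of
    index [N-1] and [N] change. With the terminal convention, the short path
    has [a_(N-1) = i'] and [b_(N-1) = j' - (i' - (i' - j'))^+ = 0]. In the long
    path the same cancellation happens one step later, so that [a_N = i] and
    [b_N = 0], while [a_(N-1) = i' + j - i] and
    [b_(N-1) = j' - (j + j' - i)^+]. Hence [a_(N-1) + b_(N-1)] changes by
    [(j + j' - i) - (j + j' - i)^+ = - (i - j - j')^+], and the three exponents
    of the recursion coefficient follow ([weight_extend]). *)

Set Implicit Arguments.
Unset Strict Implicit.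
Unset Printing Implicit Defensive.

Import Order.TTheory GRing.Theory Num.Theory.
Local Open Scope ring_scope.

(** * Half-sum coordinates *)

Lemma half_eq (t d : int) : t = 2 * d -> (t %/ 2)%Z = d.
Proof. by move=> ->; rewrite mulKz. Qed.

Lemma pos_part_id (t : int) : 0 <= t -> pos_part t = t.
Proof. by move=> t0; rewrite /pos_part; apply/max_idPl. Qed.

Lemma pos_partN (t : int) : pos_part (- t) = pos_part t - t.
Proof. rewrite /pos_part; lia. Qed.

(** The last coordinate of an admissible triple is half of an even number, and
    it is at most [c] because [x + z = c] with [x] nonnegative. *)
Lemma admissible_zcoord (k : nat) (a b c : int) : admissible k a b c ->
  [/\ c + b - a = 2 * zcoord a b c, 0 <= zcoord a b c & zcoord a b c <= c].
Proof.
case/and5P=> _ _ _ /and3P[ex _ ez] /andP[/and3P[x0 _ z0] _].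
have hz : b + c - a = 2 * zcoord a b c by rewrite /zcoord mulrC divzK.
have hx : a + c - b = 2 * xcoord a b c by rewrite /xcoord mulrC divzK.
by split=> //; lia.
Qed.

(** * Extending a path by one step *)

Section Extend.
Variables k M : nat.
Implicit Types (p : labels k M.+1) (a b : 'I_k.+1).

Definition extend p a b : labels k M.+2 :=
  (rcons_tuple p.1 a, rcons_tuple p.2 b).

Lemma extend_bij :
  bijective (fun u : labels k M.+1 * ('I_k.+1 * 'I_k.+1) =>
               extend u.1 u.2.1 u.2.2).
Proof.
apply: inj_card_bij.
  move=> [[s t] [a b]] [[s' t'] [a' b']] [] /= /rcons_inj[/val_inj -> ->].
  by move=> /rcons_inj[/val_inj -> ->].
rewrite !card_prod !card_tuple !card_ord !expnS; move: (k.+1 ^ M)%N => c.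
apply: eq_leq; ring.
Qed.

Lemma sum_extend (V : nmodType) (P : pred (labels k M.+2))
    (F : labels k M.+2 -> V) :
  \sum_(r | P r) F r =
  \sum_p \sum_a \sum_b (if P (extend p a b) then F (extend p a b) else 0).
Proof.
rewrite big_mkcond (reindex _ (onW_bij _ extend_bij)) /=.
under [RHS]eq_bigr => p _ do
  rewrite (pair_bigA _ (fun a b =>
             if P (extend p a b) then F (extend p a b) else 0)).
by rewrite (pair_bigA _ (fun p ab =>
  if P (extend p ab.1 ab.2) then F (extend p ab.1 ab.2) else 0)).
Qed.

Lemma alpha_extend p a b n :
  (n <= M)%N -> alpha (extend p a b) n.+1 = alpha p n.+1.
Proof. by move=> nM; rewrite /alpha /= nth_rcons size_tuple ltnS nM. Qed.

Lemma alpha_extend_last p a b : alpha (extend p a b) M.+2 = a%:Z.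
Proof. by rewrite /alpha /= nth_rcons size_tuple ltnn eqxx. Qed.

Lemma beta_extend p a b n :
  (n < M)%N -> beta (extend p a b) n.+1 = beta p n.+1.
Proof.
move=> nM; rewrite /beta !eqSS /= nth_rcons size_tuple nM.
by rewrite !ltn_eqF // ltnW.
Qed.

Lemma beta_extend_last p a b : beta (extend p a b) M.+1 = b%:Z.
Proof. by rewrite /beta /= nth_rcons size_tuple ltnn eqxx ltn_eqF. Qed.

Lemma xpath_extend p a b n :
  (n < M)%N -> xpath (extend p a b) n.+1 = xpath p n.+1.
Proof. by move=> h; rewrite /xpath !alpha_extend ?beta_extend // ltnW. Qed.

Lemma ypath_extend p a b n :
  (n < M)%N -> ypath (extend p a b) n.+1 = ypath p n.+1.
Proof. by move=> h; rewrite /ypath !alpha_extend ?beta_extend // ltnW. Qed.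

Lemma zpath_extend p a b n :
  (n < M)%N -> zpath (extend p a b) n.+1 = zpath p n.+1.
Proof. by move=> h; rewrite /zpath !alpha_extend ?beta_extend // ltnW. Qed.

Lemma verlinde_paths_extend l p a b :
  (extend p a b \in verlinde_paths k l M.+2) =
  (p \in verlinde_paths k l M.+1) && admissible k (alpha p M.+1) b%:Z a%:Z.
Proof.
have forallE n (P : pred 'I_n) :
    [forall i, P i] = \big[andb/true]_(i < n) P i by rewrite big_andE.
rewrite !inE alpha_extend // -andbA !forallE big_ord_recr /=.
rewrite alpha_extend // beta_extend_last alpha_extend_last.
congr (_ && (_ && _)); apply: eq_bigr => n _.
by rewrite !alpha_extend ?beta_extend // ltnW.
Qed.

End Extend.

(** * The statistics of a path and of its extension *)

Lemma ypath_terminal (k M : nat) (p : labels k M.+1) :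
  ypath p M.+1 = alpha p M.+1.
Proof.
apply: half_eq; rewrite /beta eqxx [alpha p M.+2]/alpha nth_default.
  by rewrite subr0; ring.
by rewrite size_tuple.
Qed.

(** The terminal convention kills the last [b]: since [y_N = alpha_N] and
    [alpha_N - x_(N-1) = z_(N-1)], the truncated difference removes all of
    [z_(N-1)]. *)
Lemma bcoef_terminal (k m : nat) (p : labels k m.+2) (j : nat) :
  alpha p m.+2 + beta p m.+1 - alpha p m.+1 = 2 * j%:Z -> bcoef p m.+1 = 0.
Proof.
move=> hj; rewrite /bcoef ypath_terminal.
have -> : zpath p m.+1 = j%:Z by apply: half_eq; lia.
have -> : xpath p m.+1 = alpha p m.+2 - j%:Z by apply: half_eq; lia.
by rewrite opprB addrCA subrr addr0 pos_part_id ?subrr.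
Qed.

Section Weight.
Variables (k m : nat) (p : labels k m.+2) (a b : 'I_k.+1) (j j' : nat).
Hypothesis hj : a%:Z + b%:Z - alpha p m.+2 = 2 * j%:Z.
Hypothesis hj' : alpha p m.+2 + beta p m.+1 - alpha p m.+1 = 2 * j'%:Z.

Let r := extend p a b.

Lemma acoef_extend n : (n <= m)%N -> acoef r n = acoef p n.
Proof. by move=> h; rewrite /acoef ypath_extend. Qed.

Lemma bcoef_extend n : (n < m)%N -> bcoef r n.+1 = bcoef p n.+1.
Proof.
by move=> h; rewrite /bcoef ypath_extend // xpath_extend ?zpath_extend // ltnW.
Qed.

Lemma acoef_extend_penult : acoef r m.+1 = alpha p m.+2 + j%:Z - a%:Z.
Proof.
apply: half_eq; rewrite alpha_extend // beta_extend_last alpha_extend_last.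
by lia.
Qed.

Lemma acoef_extend_last : acoef r m.+2 = a%:Z.
Proof. by rewrite /acoef ypath_terminal alpha_extend_last. Qed.

Lemma bcoef_extend_penult :
  bcoef r m.+1 = j'%:Z - pos_part (j%:Z + j'%:Z - a%:Z).
Proof.
rewrite /bcoef -[ypath r _]/(acoef r m.+1) acoef_extend_penult.
rewrite zpath_extend // xpath_extend //.
have -> : zpath p m.+1 = j'%:Z by apply: half_eq; lia.
have -> : xpath p m.+1 = alpha p m.+2 - j'%:Z by apply: half_eq; lia.
by congr (_ - pos_part _); ring.
Qed.

Lemma bcoef_extend_last : bcoef r m.+2 = 0.
Proof.
apply: (@bcoef_terminal _ _ _ j).
by rewrite alpha_extend_last beta_extend_last alpha_extend.
Qed.

Lemma step_extend n : (1 <= n < m.+1)%N ->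
  acoef r n + bcoef r n = acoef p n + bcoef p n.
Proof. by case: n => // n /= h; rewrite acoef_extend // bcoef_extend. Qed.

(** The change at index [N-1], namely [t - t^+] for [t = j + j' - a], is a
    negative part; this is how [(a - j - j')^+] enters the exponents. *)
Lemma step_extend_penult :
  acoef r m.+1 + bcoef r m.+1 =
  acoef p m.+1 + bcoef p m.+1 - pos_part (a%:Z - j%:Z - j'%:Z).
Proof.
rewrite acoef_extend_penult bcoef_extend_penult (bcoef_terminal hj').
rewrite /acoef ypath_terminal.
have -> : a%:Z - j%:Z - j'%:Z = - (j%:Z + j'%:Z - a%:Z) by ring.
by rewrite pos_partN; ring.
Qed.

Lemma energy_extend :
  energy r = m.+2%:Z * a%:Z - (m.+2%:Z - 1) * pos_part (a%:Z - j%:Z - j'%:Z)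
             + energy p.
Proof.
rewrite /energy (big_nat_recr m.+2) //= !(big_nat_recr m.+1) //= step_extend_penult.
rewrite acoef_extend_last bcoef_extend_last.
have -> : \sum_(1 <= i < m.+1) i%:Z * (acoef r i + bcoef r i) =
          \sum_(1 <= i < m.+1) i%:Z * (acoef p i + bcoef p i).
  by apply: eq_big_nat => n hn; rewrite step_extend.
have -> : m.+2%:Z - 1 = m.+1%:Z by lia.
by ring.
Qed.

Lemma spin1_extend :
  spin1 r = j'%:Z - pos_part (j%:Z + j'%:Z - a%:Z) + spin1 p.
Proof.
rewrite /spin1 (big_nat_recr m.+2) //= !(big_nat_recr m.+1) //= bcoef_extend_last bcoef_extend_penult.
rewrite (bcoef_terminal hj').
have -> : \sum_(1 <= i < m.+1) bcoef r i = \sum_(1 <= i < m.+1) bcoef p i.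
  by apply: eq_big_nat => -[//|n] hn; rewrite bcoef_extend.
by ring.
Qed.

Lemma spin2_extend :
  spin2 r = a%:Z - pos_part (a%:Z - j%:Z - j'%:Z) + spin2 p.
Proof.
rewrite /spin2 (big_nat_recr m.+2) //= !(big_nat_recr m.+1) //= step_extend_penult.
rewrite acoef_extend_last bcoef_extend_last acoef_extend //.
rewrite (eq_big_nat _ _ step_extend).
by ring.
Qed.

End Weight.

(** * Summing over paths *)

(** The two end data are taken in [nat] in order to be compared with the
    summation indices [i'] and [j']; by [endP] the absolute values lose nothing
    on Verlinde paths. *)
Definition end_label (k N : nat) (p : labels k N) : nat := `|alpha p N|%N.
Definition end_spin (k N : nat) (p : labels k N) : nat := `|zpath p N.-1|%N.

Lemma endP (k l m : nat) (p : labels k m.+2) :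
  p \in verlinde_paths k l m.+2 ->
  [/\ alpha p m.+2 = (end_label p)%:Z,
      alpha p m.+2 + beta p m.+1 - alpha p m.+1 = 2 * (end_spin p)%:Z,
      (end_label p <= k)%N & (end_spin p <= end_label p)%N].
Proof.
rewrite inE => /andP[_ /forallP/(_ ord_max)] /= hadm.
have [hz z0 zle] := admissible_zcoord hadm.
have a0 : 0 <= alpha p m.+2 <= k%:Z by case/and5P: hadm.
rewrite -/(zpath p m.+1) in hz z0 zle.
by rewrite /end_label /end_spin [m.+2.-1]/=; split; lia.
Qed.

(** Each path has a single pair of end data, and that pair lies in the range of
    the double sum. *)
Lemma sum_over_ends (V : nmodType) (k l m : nat) (p : labels k m.+2)
    (F : nat -> nat -> V) :
  p \in verlinde_paths k l m.+2 ->
  \sum_(i' < k.+1) \sum_(j' < i'.+1)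
    (if (alpha p m.+2 == i'%:Z) &&
        (alpha p m.+2 + beta p m.+1 - alpha p m.+1 == 2 * j'%:Z)
     then F i' j' else 0) =
  F (end_label p) (end_spin p).
Proof.
move=> /endP[hi hj lei lej]; rewrite hj hi.
have hi1 : (end_label p < k.+1)%N by [].
have hj1 : (end_spin p < (end_label p).+1)%N by [].
rewrite (bigD1 (Ordinal hi1)) //= [X in _ + X]big1 ?addr0; last first.
  move=> i' ni; rewrite big1 // => j' _.
  by case: ifP => // /andP[/eqP e _]; case/eqP: ni; apply: val_inj => /=; lia.
rewrite (bigD1 (Ordinal hj1)) //= [X in _ + X]big1 ?addr0; last first.
  move=> j' nj.
  by case: ifP => // /andP[_ /eqP e]; case/eqP: nj; apply: val_inj => /=; lia.
by rewrite !eqxx.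
Qed.

Section Recursion.
Variables (A : comUnitRingType) (q z1 z2 : A).
Hypotheses (hq : q \is a GRing.unit) (hz1 : z1 \is a GRing.unit)
  (hz2 : z2 \is a GRing.unit).

Definition weight (k N : nat) (p : labels k N) : A :=
  q ^ energy p * z1 ^ spin1 p * z2 ^ spin2 p.

Lemma weight_extend (k m : nat) (p : labels k m.+2) (a b : 'I_k.+1)
    (i' j j' : nat) :
  alpha p m.+2 = i'%:Z ->
  a%:Z + b%:Z - alpha p m.+2 = 2 * j%:Z ->
  alpha p m.+2 + beta p m.+1 - alpha p m.+1 = 2 * j'%:Z ->
  admissible k (alpha p m.+2) b%:Z a%:Z ->
  weight (extend p a b) =
  recursion_coef q z1 z2 k m.+2 a j i' j' * weight p.
Proof.
move=> hi' hj hj' hadm; rewrite /recursion_coef -hi'.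
have -> : 2 * j%:Z - a%:Z + alpha p m.+2 = b%:Z by lia.
rewrite hadm /weight (energy_extend hj hj') (spin1_extend hj hj').
by rewrite (spin2_extend hj hj') !exprzDr //; ring.
Qed.

(** For a fixed truncation, both labels of the added step are determined by
    [i] and [j]. When the resulting triple is admissible it lies in the range of
    the labels, so that one term survives; otherwise both sides vanish. *)
Lemma sum_over_steps (k l m i j : nat) (p : labels k m.+2) :
  (i <= k)%N -> p \in verlinde_paths k l m.+2 ->
  \sum_(a < k.+1) \sum_(b < k.+1)
    (if [&& admissible k (alpha p m.+2) b%:Z a%:Z, a%:Z == i%:Z
         & a%:Z + b%:Z - alpha p m.+2 == 2 * j%:Z]
     then weight (extend p a b) else 0) =
  recursion_coef q z1 z2 k m.+2 i j (end_label p) (end_spin p) * weight p.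
Proof.
move=> ik /endP[hi' hj' _ _]; have ik1 : (i < k.+1)%N by [].
rewrite (bigD1 (Ordinal ik1)) //= [X in _ + X]big1 ?addr0; last first.
  move=> a ai; rewrite big1 // => b _.
  case: ifP => // /and3P[_ /eqP ea _]; case/eqP: ai; apply: val_inj => /=.
  by lia.
case: (boolP (admissible k (alpha p m.+2)
                (2 * j%:Z - i%:Z + alpha p m.+2) i%:Z)) => [hadm|nadm].
  have /andP[b0 bk] : 0 <= 2 * j%:Z - i%:Z + alpha p m.+2 <= k%:Z.
    by case/and5P: hadm.
  have [c eb] : exists c : nat, 2 * j%:Z - i%:Z + alpha p m.+2 = c%:Z.
    by case: (2 * j%:Z - i%:Z + alpha p m.+2) b0 => // c _; exists c.
  have hb : (c < k.+1)%N by lia.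
  rewrite (bigD1 (Ordinal hb)) //= [X in _ + X]big1 ?addr0; last first.
    move=> b nb; case: ifP => // /and3P[_ _ /eqP e].
    by case/eqP: nb; apply: val_inj => /=; lia.
  have hj : i%:Z + c%:Z - alpha p m.+2 = 2 * j%:Z by lia.
  rewrite eb in hadm; rewrite hadm hj !eqxx /=.
  exact: (weight_extend (a := Ordinal ik1) (b := Ordinal hb)) hadm.
rewrite big1 => [|b _].
  by rewrite /recursion_coef -hi' (negbTE nadm) mul0r.
case: ifP => // /and3P[hadm _ /eqP e]; case/negP: nadm.
by have -> : 2 * j%:Z - i%:Z + alpha p m.+2 = b%:Z by lia.
Qed.

End Recursion.

Theorem proposition3p5p1 (A : comUnitRingType) (q z1 z2 : A)
    (hq : q \is a GRing.unit) (hz1 : z1 \is a GRing.unit)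
    (hz2 : z2 \is a GRing.unit) (k l N i j : nat)
    (hk : (1 <= k)%N) (hl : (l <= k)%N) (hN : (2 <= N)%N)
    (hji : (j <= i)%N) (hik : (i <= k)%N) :
  partial_character q z1 z2 k l N.+1 i j =
  \sum_(i' < k.+1) \sum_(j' < i'.+1)
    recursion_coef q z1 z2 k N i j i' j' *
    partial_character q z1 z2 k l N i' j'.
Proof.
case: N hN => [|[|m]] // _.
transitivity (\sum_(p in verlinde_paths k l m.+2)
  recursion_coef q z1 z2 k m.+2 i j (end_label p) (end_spin p) *
  weight q z1 z2 p).
  rewrite /partial_character sum_extend [RHS]big_mkcond /=.
  apply: eq_bigr => p _; case: ifP => hp; last first.
    rewrite big1 // => a _; rewrite big1 // => b _.
    by rewrite verlinde_paths_extend hp.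
  rewrite -(sum_over_steps hq hz1 hz2 j hik hp).
  apply: eq_bigr => a _; apply: eq_bigr => b _.
  rewrite verlinde_paths_extend hp alpha_extend_last beta_extend_last.
  by rewrite alpha_extend // -andbA.
symmetry.
under eq_bigr => i' _.
  under eq_bigr => j' _ do rewrite /partial_character big_mkcondr mulr_sumr.
  rewrite exchange_big; over.
rewrite exchange_big; apply: eq_bigr => p hp /=.
rewrite -(sum_over_ends (fun i' j' =>
  recursion_coef q z1 z2 k m.+2 i j i' j' * weight q z1 z2 p) hp).
apply: eq_bigr => i' _; apply: eq_bigr => j' _.
by case: ifP; rewrite // mulr0.
Qed.
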